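(* Let $A$ be a complex affine Poisson algebra and $P$ a Poisson prime ideal of $A$. If $P$ is Poisson rational then $P$ is Poisson primitive.
   Context: A Poisson algebra over a field $k$ is a commutative $k$-algebra $A$ with a $k$-bilinear Lie bracket $\{-,-\}$ such that $\{-,x\}$ is a derivation of $A$ for every $x\in A$. An affine $k$-algebra is a finitely generated $k$-algebra that is an integral domain; ''complex'' means $k=\mathbb C$. A Poisson ideal is an ideal $I$ with $\{I,A\}\subseteq I$; a Poisson prime ideal is a prime ideal that is a Poisson ideal. A Poisson prime $P$ is Poisson primitive if it is the Poisson core (the largest Poisson ideal contained in) of some maximal ideal of $A$. A Poisson prime $P$ is Poisson rational if the Poisson centre $\{z : \{z,-\}\equiv 0\}$ of $\operatorname{Frac}(A/P)$ (with the bracket induced from $A$ and uniquely extended to the fraction field) is algebraic over the base field. *)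

(* Defs.v *)
From HB Require Import structures.
From mathcomp Require Import all_boot all_order all_algebra.
From mathcomp Require Import boolp reals.
From mathcomp.real_closed Require Import complex.

Set Implicit Arguments.
Unset Strict Implicit.
Unset Printing Implicit Defensive.

Import GRing.Theory.
Local Open Scope ring_scope.
Local Open Scope quotient_scope.

Notation Cx R := (R[i]) (only parsing).

Section Poisson.
Variables (k : fieldType) (A : comAlgType k).

Definition is_poisson_bracket (br : A -> A -> A) : Prop :=
  [/\ (forall (c : k) (x y z : A), br (c *: x + y) z = c *: br x z + br y z),
      (forall (c : k) (x y z : A), br z (c *: x + y) = c *: br z x + br z y),
      (forall x : A, br x x = 0),
      (forall x y z : A, br x (br y z) + br y (br z x) + br z (br x y) = 0) &
      (forall x y z : A, br (x * y) z = x * br y z + br x z * y)].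

Definition finitely_generated : Prop :=
  exists s : seq A, forall S : {pred A}, GRing.subalg_closed S ->
    {subset s <= S} -> forall a : A, a \in S.

Definition is_domain : Prop := forall x y : A, x * y = 0 -> x = 0 \/ y = 0.

Definition affine : Prop := finitely_generated /\ is_domain.

Variable br : A -> A -> A.

(* (proper) ideals: [idealr_closed] from ring_quotient says 0 \in I,
   1 \notin I and a*u+v \in I for u, v \in I. *)
Definition maximal_ideal (M : {pred A}) : Prop :=
  idealr_closed M /\
  forall J : {pred A}, idealr_closed J -> {subset M <= J} -> J =i M.

(* An ideal I is a Poisson ideal if {I, A} \subseteq I.  Here ideals are
   proper (1 \notin I); every Poisson ideal considered below is contained
   in a proper ideal anyway. *)
Definition poisson_ideal (I : {pred A}) : Prop :=
  idealr_closed I /\ forall x y : A, x \in I -> br x y \in I.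

Definition is_poisson_core (M P : {pred A}) : Prop :=
  [/\ poisson_ideal P, {subset P <= M} &
      forall J : {pred A}, poisson_ideal J -> {subset J <= M} -> {subset J <= P}].

Definition poisson_primitive (P : {pred A}) : Prop :=
  exists M : {pred A}, maximal_ideal M /\ is_poisson_core M P.

End Poisson.

Definition quot_dom (R : comNzRingType) (I : prime_idealr R) := {ideal_quot I}.

HB.instance Definition _ (R : comNzRingType) (I : prime_idealr R) :=
  GRing.ComNzRing.on (quot_dom I).

Section QuotUnit.
Variables (R : comNzRingType) (I : prime_idealr R).
Local Notation Q := (quot_dom I).

Definition qunit : pred Q := fun x => `[< exists y : Q, y * x = 1 >].
Definition qinv (x : Q) : Q :=
  match pselect (exists y : Q, y * x = 1) with
  | left h => projT1 (cid h)
  | right _ => x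
  end.

Lemma qmulVr : {in qunit, left_inverse 1 qinv *%R}.
Proof.
move=> x; rewrite unfold_in /qunit => /asboolP h; rewrite /qinv.
case: pselect => [h'|//]; exact: (projT2 (cid h')).
Qed.

Lemma qunitPl (x y : Q) : y * x = 1 -> qunit x.
Proof. by move=> h; apply/asboolP; exists y. Qed.

Lemma qinv_out : {in [predC qunit], qinv =1 id}.
Proof.
move=> x; rewrite !inE /qunit => /asboolP h; rewrite /qinv.
by case: pselect.
Qed.

HB.instance Definition _ :=
  GRing.ComNzRing_hasMulInverse.Build Q qmulVr qunitPl qinv_out.

Lemma qdom (x y : Q) : x * y = 0 -> (x == 0) || (y == 0).
Proof. exact: Quotient.rquot_IdomainAxiom. Qed.

HB.instance Definition _ := GRing.ComUnitRing_isIntegral.Build Q qdom.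

End QuotUnit.

Section Induced.
Variables (R : comNzRingType) (I : prime_idealr R) (br : R -> R -> R).

(* bracket induced on A/P (well defined when P is a Poisson ideal) *)
Definition quot_br (x y : quot_dom I) : quot_dom I :=
  \pi_(quot_dom I) (br (repr x) (repr y)).

End Induced.

Section FracBr.
Variables (D : idomainType) (br : D -> D -> D).
Local Notation F := {fraction D}.
Local Notation "x %:F" := (@FracField.tofrac D x).

(* The unique extension of a Poisson bracket of D to Frac(D):
   {a/s, c/t} = (s({a,c}t - c{a,t}) - a({s,c}t - c{s,t})) / (s^2 t^2). *)
Definition frac_br (u v : F) : F :=
  let a := \n_(repr u) in let s := \d_(repr u) in
  let c := \n_(repr v) in let t := \d_(repr v) in
  ((s * (br a c * t - c * br a t) - a * (br s c * t - c * br s t))%:F)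
    / ((s ^+ 2 * t ^+ 2)%:F).

Definition frac_poisson_centre : pred F :=
  fun z => `[< forall w : F, frac_br z w = 0 >].

End FracBr.

Local Notation "x %:F" := (@FracField.tofrac _ x).

Definition algebraic_over (k : fieldType) (K : nzRingType) (f : k -> K) (x : K) :=
  exists2 p : {poly k}, p != 0 & root (map_poly f p) x.

Definition poisson_rational (k : fieldType) (A : comAlgType k)
    (br : A -> A -> A) (P : prime_idealr A) : Prop :=
  forall z : {fraction quot_dom P},
    z \in frac_poisson_centre (@quot_br _ P br) ->
    algebraic_over (fun c : k => (\pi_(quot_dom P) (c%:A) : quot_dom P)%:F) z.

(* Main.v *)
Require Import Defs.
From HB Require Import structures.
From mathcomp Require Import all_boot all_order all_algebra.
From mathcomp Require Import boolp reals.
From mathcomp.real_closed Require Import complex.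
From mathcomp Require Import classical_sets.
From mathcomp Require Import ring.

(** We work in [A] modulo [P].  Rationality says that the only Poisson central
    fractions are scalars, so generalised Wronskians built from the operators
    [{-, x}] detect linear independence over the scalars: every
    finite-dimensional subspace [V] of [A] has a witness [f] outside [P] lying
    in every Poisson ideal that contains [P] and meets [V] outside [P].  As [A]
    is a countable union of such subspaces, countably many [f_n] meet all
    Poisson ideals strictly above [P].  The ideals containing [P] and avoiding
    all products of the [f_n] have a maximal element [M], and since the field
    is uncountable while [A] has countable dimension, [A / M] is the field of
    scalars.  So [M] is a maximal ideal of [A], and its Poisson core is [P]. *)

Set Implicit Arguments.
Unset Strict Implicit.
Unset Printing Implicit Defensive.

Import Order.TTheory GRing.Theory Num.Theory.
Local Open Scope ring_scope.

(** * Poisson operators modulo [P] and generalised Wronskians *)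

Section PoissonModulo.
Variables (k : fieldType) (A : comAlgType k) (br : A -> A -> A).
Variable (P : prime_idealr A).
Hypothesis brP : is_poisson_bracket br.
Hypothesis PP : poisson_ideal br P.

Lemma br_linearl c x y z : br (c *: x + y) z = c *: br x z + br y z.
Proof. by case: brP => h _ _ _ _; apply: h. Qed.

Lemma brDl x y z : br (x + y) z = br x z + br y z.
Proof. by have := br_linearl 1 x y z; rewrite !scale1r. Qed.

Lemma brNl x z : br (- x) z = - br x z.
Proof.
have br0 : br 0 z = 0.
  by apply: (addrI (br 0 z)); rewrite -brDl !addr0.
by have := br_linearl (-1) x 0 z; rewrite !scaleN1r br0 !addr0.
Qed.

Lemma brBl x y z : br (x - y) z = br x z - br y z.
Proof. by rewrite brDl brNl. Qed.

Lemma br_antisym x y : br x y = - br y x.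
Proof.
have [_ hr hx _ _] := brP.
have brDr a b z : br z (a + b) = br z a + br z b.
  by have := hr 1 a b z; rewrite !scale1r.
have := hx (x + y); rewrite brDl !brDr !hx add0r addr0 => /eqP.
by rewrite addr_eq0 => /eqP.
Qed.

Lemma brBr x y z : br z (x - y) = br z x - br z y.
Proof. by rewrite br_antisym brBl opprB addrC (br_antisym z x) (br_antisym z y) opprK addrC. Qed.

Lemma brMl x y z : br (x * y) z = x * br y z + br x z * y.
Proof. by case: brP => _ _ _ _; apply. Qed.

Lemma br_inl x y : x \in P -> br x y \in P.
Proof. by case: PP => _; apply. Qed.

Lemma br_inr x y : y \in P -> br x y \in P.
Proof. by move=> yP; rewrite br_antisym rpredN br_inl. Qed.


(** This is the linear span of [s] plus [P], with one coefficient peeled off at a time to suit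
    induction on [s]. *)
Fixpoint spanmod (s : seq A) (x : A) : Prop :=
  if s is a :: s' then exists c : k, spanmod s' (x - c *: a) else x \in P.

Lemma idealZ c x : x \in P -> c *: x \in P.
Proof. by move=> xP; rewrite -mulr_algl idealMr. Qed.

Lemma spanmod_lin s c x y :
  spanmod s x -> spanmod s y -> spanmod s (c *: x + y).
Proof.
elim: s x y => [|a s IH] x y /=; first by move=> xP yP; rewrite rpredD ?idealZ.
move=> [d xs] [e ys]; exists (c * d + e).
have -> : c *: x + y - (c * d + e) *: a = c *: (x - d *: a) + (y - e *: a).
  by rewrite scalerBr scalerDl scalerA opprD addrACA.
exact: IH.
Qed.

(** The last constructor has the shape of a two-by-two determinant, as needed to eliminate a vector
    between two operators. *)
Inductive diffop : (A -> A) -> Prop :=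
| diffop_id : diffop id
| diffop_br T x : diffop T -> diffop (fun v => br (T v) x)
| diffop_comb f g T U :
    diffop T -> diffop U -> diffop (fun v => f * T v - g * U v).

Lemma diffop_lin T : diffop T -> forall c x y, T (c *: x + y) = c *: T x + T y.
Proof.
elim=> [//|U z _ IH|f g U V _ IHU _ IHV] c x y; first by rewrite IH br_linearl.
by rewrite IHU IHV !mulrDr -!scalerAr scalerBr opprD addrACA.
Qed.

(** The closure conditions mirror the constructors of [diffop]. Unlike in [poisson_ideal], [1] is
    allowed in [N]. *)
Definition poisson_stable (N : A -> Prop) : Prop :=
  (forall f g x y, N x -> N y -> N (f * x - g * y)) /\
  forall x y, N x -> N (br x y).

Lemma diffop_stable N T x : poisson_stable N -> diffop T -> N x -> N (T x).
Proof.
move=> [Ncomb Nbr] dT Nx; elim: dT => [//|U z _ IH|f g U V _ IHU _ IHV].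
  exact: Nbr.
exact: Ncomb.
Qed.

Lemma poisson_stableP : poisson_stable (fun x => x \in P).
Proof. by split=> [f g x y xP yP|x y]; [rewrite rpredB ?idealMr | exact: br_inl]. Qed.

Lemma diffop_kill_span s T x : diffop T -> (forall a, a \in s -> T a \in P) ->
  spanmod s x -> T x \in P.
Proof.
move=> dT; elim: s x => [|a s IH] x kill /=.
  exact: (diffop_stable poisson_stableP dT).
case=> c /IH xs; rewrite -(subrK (c *: a) x) addrC diffop_lin // rpredD //.
  by rewrite idealZ // kill // mem_head.
by apply: xs => b bs; rewrite kill // inE bs orbT.
Qed.

Section Rational.
(** By the quotient rule, the premise says that [a / s] is Poisson central modulo [P]. *)
Hypothesis ratP : forall a s, s \notin P ->
  (forall x, br s x * a - s * br a x \in P) -> exists c : k, a - c *: s \in P.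

(* A triangular form of the nonvanishing of generalised Wronskians: if every
   operator killing [a :: s] also kills [v], then for [T1] killing [s] but not
   [a], the quotient [T1 v / T1 a] is Poisson central, hence a scalar. *)
Lemma diffop_separates s v : ~ spanmod s v ->
  exists T, [/\ diffop T, forall a, a \in s -> T a \in P & T v \notin P].
Proof.
elim: s v => [|a s IH] v /= vs.
  by exists id; split=> //; [exact: diffop_id | exact/negP].
apply: contrapT => noT.
have killv T : diffop T -> (forall b, b \in s -> T b \in P) -> T a \in P ->
    T v \in P.
  move=> dT ks ka; apply: contrapT => /negP vP; apply: noT; exists T; split=> //.
  by move=> b; rewrite inE => /predU1P[-> //|/ks].
have [sa|nsa] := pselect (spanmod s a).
  have [sv|nsv] := pselect (spanmod s v).
    by apply: vs; exists 0; rewrite scale0r subr0.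
  have [T [dT ks /negP[]]] := IH _ nsv.
  by apply: killv => //; apply: diffop_kill_span sa.
have [T1 [dT1 k1 fP]] := IH _ nsa.
set f := T1 a in fP; pose u := T1 v.
(* The combination of [T] and [T1] that cancels at [a] kills [a :: s], hence [v]. *)
have key T : diffop T -> (forall b, b \in s -> T b \in P) ->
    f * T v - T a * u \in P.
  move=> dT ks; apply: (killv (fun w => f * T w - T a * T1 w)).
  - exact: diffop_comb.
  - by move=> b bs; rewrite rpredB ?idealMr ?ks ?k1.
  - by rewrite mulrC subrr rpred0.
(* This is [key] for [T1] followed by [{-, x}], which still kills [s] because [P] is a Poisson
   ideal. *)
have central x : br f x * u - f * br u x \in P.
  have h1 := br_inl x (key _ dT1 k1).
  have h2 := key _ (diffop_br x dT1) (fun b bs => br_inl x (k1 b bs)).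
  rewrite brBl !brMl -/f -/u in h1; rewrite /= -/f -/u in h2.
  have := rpredB h1 h2; congr (_ \in P); ring.
have [c uc] := ratP fP central.
(* An operator [T] killing [s] but not [v - c a] cannot exist: modulo [P], [f * T (v - c a)] equals
   [T a * (u - c f)], which lies in [P]. *)
apply: vs; exists c; apply: contrapT => /IH[T [dT ks /negP[]]].
have : f * T (v - c *: a) \in P.
  rewrite addrC -scaleNr diffop_lin //.
  have := rpredD (key _ dT ks) (idealMr (T a) uc); congr (_ \in P).
  rewrite scaleNr -[c *: T a]mulr_algl -[c *: f]mulr_algl; ring.
by rewrite prime_idealrM (negPf fP).
Qed.

(** The witness is a product of factors [T a], one for each [a] independent of the later elements,
    where [T] kills those elements but not [a]. If [x] has a nonzero coefficient [c] at [a], then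
    [T x] is [c T a] modulo [P], so [T a] lies in [N]; otherwise the witness of the tail applies. *)
Lemma poisson_witness s : exists2 f, f \notin P &
  forall N, poisson_stable N -> (forall x, x \in P -> N x) ->
  forall x, N x -> spanmod s x -> x \notin P -> N f.
Proof.
elim: s => [|a s [f fP IH]] /=.
  by exists 1; rewrite ?idealr1 // => N _ _ x _ -> .
have [sa|/diffop_separates[T [dT ks aP]]] := pselect (spanmod s a).
  exists f => // N sN PN x Nx [c xs]; apply: (IH _ sN PN _ Nx).
  by rewrite -(subrK (c *: a) x) addrC; apply: spanmod_lin.
exists (f * T a) => [|N sN PN x Nx [c xs] xP].
  by rewrite prime_idealrM negb_or fP.
have Nmul g y : N y -> N (g * y).
  by move=> Ny; have := sN.1 g 0 _ _ Ny Ny; rewrite mul0r subr0.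
have [c0|c0] := eqVneq c 0.
  rewrite mulrC; apply: Nmul; apply: (IH _ sN PN _ Nx) => //.
  by rewrite c0 scale0r subr0 in xs.
apply: Nmul.
have rP := diffop_kill_span dT ks xs.
have -> : T a = c^-1%:A * T x - c^-1%:A * T (x - c *: a).
  have Tx : T x = c *: T a + T (x - c *: a) by rewrite -diffop_lin // addrC subrK.
  by rewrite {1}Tx mulrDr addrK mulr_algl scalerA mulVf // scale1r.
by apply: sN.1; [exact: (diffop_stable sN dT Nx) | exact: PN].
Qed.

End Rational.
End PoissonModulo.

(** * The Poisson centre of the fraction field of [A / P] *)

Section Centre.
Variables (k : closedFieldType) (A : comAlgType k) (br : A -> A -> A).
Variable (P : prime_idealr A).
Hypothesis brP : is_poisson_bracket br.
Hypothesis PP : poisson_ideal br P.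

Local Open Scope quotient_scope.
Local Notation D := (quot_dom P).
Local Notation "x %:F" := (@FracField.tofrac _ x).
Local Notation dbr := (@quot_br _ P br).

Definition quot_pi : {rmorphism A -> D} := \pi_D.

Lemma quot_pi_eq0 (x : A) : (quot_pi x == 0) = (x \in P).
Proof.
rewrite -(rmorph0 quot_pi) -[in RHS](subr0 x).
exact: esym (Quotient.idealrBE P x 0).
Qed.

Lemma quot_pi_eq (x y : A) : quot_pi x = quot_pi y <-> x - y \in P.
Proof.
rewrite -quot_pi_eq0 rmorphB subr_eq0; by split=> /eqP.
Qed.

Lemma quot_pi_br x y : quot_pi (br x y) = dbr (quot_pi x) (quot_pi y).
Proof.
rewrite /quot_br; set x' := repr _; set y' := repr _.
have xx : x - x' \in P by apply/quot_pi_eq; rewrite /quot_pi /= reprK.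
have yy : y - y' \in P by apply/quot_pi_eq; rewrite /quot_pi /= reprK.
apply/quot_pi_eq.
have := rpredD (br_inl PP y xx) (br_inr brP PP x' yy).
by rewrite (brBl brP) (brBr brP) addrA subrK.
Qed.

Lemma quot_pi_surj (d : D) : exists a, d = quot_pi a.
Proof. by exists (repr d); rewrite /quot_pi /= reprK. Qed.

Definition quot_frac : {rmorphism A -> {fraction D}} :=
  (@FracField.tofrac D) \o quot_pi.

Lemma frac_numden (R : idomainType) (z : {fraction R}) : 
   z = (\n_(repr z))%:F / (\d_(repr z))%:F.
Proof.
rewrite -{1}[z]reprK; set r := repr z; unlock FracField.tofrac.
rewrite -[X in _ = _ * X]FracField.pi_inv -[RHS]FracField.pi_mul.
rewrite /FracField.invf /FracField.mulf !numden_Ratio ?oner_neq0 ?denom_ratioP //.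
by rewrite mulr1 mul1r Ratio_numden.
Qed.

(** Over an algebraically closed field the annihilating polynomial splits, so [z] is a root of a
    linear factor. *)
Lemma algebraic_scalar z :
  algebraic_over (fun c : k => (\pi_D (c%:A) : D)%:F) z ->
  exists c, z = quot_frac c%:A.
Proof.
pose f : {rmorphism k -> {fraction D}} := quot_frac \o (in_alg A).
case=> p p0 rt; have {}rt : root (map_poly f p) z := rt.
have [r defp] := closed_field_poly_normal p.
move: rt; rewrite defp map_polyZ rmorph_prod rootZ ?fmorph_eq0 ?lead_coef_eq0 //.
rewrite rootE horner_prod prodf_seq_eq0 => /hasP[c _ /=].
rewrite map_polyXsubC hornerXsubC subr_eq0 => /eqP->.
by exists c.
Qed.


Hypothesis rat : poisson_rational br P.

(** [frac_br] computes with a chosen representative [n / d] of [a / s], so the quotient-rule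
    condition has to be carried over from the pair [a], [s] to the pair [n], [d]. *)
Lemma rational_centre (a s : A) : s \notin P ->
  (forall x, br s x * a - s * br a x \in P) -> exists c : k, a - c *: s \in P.
Proof.
move=> sP cen.
pose z := quot_frac a / quot_frac s.
have s0 : quot_frac s != 0.
  by rewrite /quot_frac /= tofrac_eq0 quot_pi_eq0.
suff /rat/algebraic_scalar[c zc] : z \in frac_poisson_centre dbr.
  exists c; rewrite -quot_pi_eq0 rmorphB -(tofrac_eq0) rmorphB subr_eq0.
  apply/eqP; rewrite -mulr_algl rmorphM rmorphM.
  rewrite -[LHS]/(quot_frac a) -[RHS]/(quot_frac c%:A * quot_frac s) -zc.
  by rewrite divfK.
apply/asboolP => w.
rewrite /frac_br.
set n := \n_(repr z); set d := \d_(repr z).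
have d0 : d%:F != 0 by rewrite tofrac_eq0 denom_ratioP.
suff nd x : d * dbr n x = n * dbr d x.
  set c := \n_(repr w); set t := \d_(repr w).
  rewrite (_ : _ - _ = 0) ?tofrac0 ?mul0r //.
  have hc := nd c; have ht := nd t.
  have -> : d * (dbr n c * t - c * dbr n t) - n * (dbr d c * t - c * dbr d t) =
   (d * dbr n c - n * dbr d c) * t - c * (d * dbr n t - n * dbr d t) by ring.
  by rewrite hc ht !subrr mul0r mulr0 subr0.
have [x' ->] := quot_pi_surj x.
have [N nN] := quot_pi_surj n; have [E dE] := quot_pi_surj d.
rewrite nN dE -!quot_pi_br -!rmorphM; apply/quot_pi_eq.
have cross : N * s - a * E \in P.
  apply/quot_pi_eq; rewrite !rmorphM -nN -dE; apply/eqP; rewrite -tofrac_eq.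
  apply/eqP; rewrite !tofracM.
  rewrite -[(quot_pi s)%:F]/(quot_frac s) -[(quot_pi a)%:F]/(quot_frac a).
  rewrite -(divfK s0 (quot_frac a)) -/z [in RHS](frac_numden z) -/n -/d.
  by rewrite mulrAC divfK.
have h1 := br_inl PP x' cross.
have h2 := cen x'.
rewrite (brBl brP) !(brMl brP) in h1.
(* After multiplication by [s ^+ 2] the condition is a combination of the bracket of [cross] with
   [x'], of [cen] and of [cross]; primality of [P] then cancels [s]. *)
have : s * (s * (E * br N x' - N * br E x')) \in P.
  have := rpredD (idealMr (s * E) h1)
    (rpredD (idealMr (- (E * E)) h2)
            (idealMr (- (E * br s x' + s * br E x')) cross)).
  congr (_ \in P); ring.
by rewrite !prime_idealrM (negPf sP).
Qed.

End Centre.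

(** * Finite-dimensional spans modulo [P] *)

Section Span.
Variables (k : fieldType) (A : comAlgType k) (P : prime_idealr A).
Local Notation spanmod := (spanmod P).

Lemma spanmod_ind (Q : A -> Prop) (s : seq A) :
  (forall x, x \in P -> Q x) -> (forall a, a \in s -> Q a) ->
  (forall c x y, Q x -> Q y -> Q (c *: x + y)) ->
  forall x, spanmod s x -> Q x.
Proof.
move=> QP Qs Qlin; elim: s Qs => [|a s IH] Qs x /=; first exact: QP.
case=> c /IH Qx; rewrite -(subrK (c *: a) x) addrC; apply: Qlin.
  by apply: Qs; apply: mem_head.
by apply: Qx => b bs; apply: Qs; rewrite inE bs orbT.
Qed.

Lemma spanmod_ideal s x : x \in P -> spanmod s x.
Proof. by elim: s x => //= a s IH x xP; exists 0; rewrite scale0r subr0; apply: IH. Qed.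

Lemma spanmod_mem s a : a \in s -> spanmod s a.
Proof.
elim: s => //= b s IH; rewrite inE => /predU1P[->|/IH sa].
  by exists 1; rewrite scale1r subrr; apply: spanmod_ideal; rewrite rpred0.
by exists 0; rewrite scale0r subr0.
Qed.

Lemma spanmod_sub s t x : {subset s <= t} -> spanmod s x -> spanmod t x.
Proof.
move=> st; apply: spanmod_ind => [|a /st|]; first exact: spanmod_ideal.
  exact: spanmod_mem.
by move=> c y z; apply: spanmod_lin.
Qed.

Lemma spanmod_mul s t x y : spanmod s x -> spanmod t y ->
  spanmod [seq a * b | a <- s, b <- t] (x * y).
Proof.
move=> sx ty; move: x sx; apply: spanmod_ind => [x xP|a aS|c x x' xy x'y].
- by apply: spanmod_ideal; rewrite mulrC idealMr.
- move: y ty; apply: spanmod_ind => [y yP|b bt|c y y' ay ay'].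
  + by apply: spanmod_ideal; rewrite idealMr.
  + by apply: spanmod_mem; apply: allpairs_f.
  + by rewrite mulrDr -scalerAr; apply: spanmod_lin.
- by rewrite mulrDl -scalerAl; apply: spanmod_lin.
Qed.

(** Starting from [1] and the generators, all pairwise products are added repeatedly; the union of
    the spans is a subalgebra containing the generators. *)
Lemma finitely_generated_filtration : finitely_generated A ->
  exists B : nat -> seq A, forall x, exists n, spanmod (B n) x.
Proof.
move=> [s gen].
pose step (t : seq A) := t ++ [seq a * b | a <- t, b <- t].
pose B n := iter n step (1 :: s).
have Bstep n : {subset B n <= B n.+1} by move=> x; rewrite mem_cat => ->.
have Bmono n m : (n <= m)%N -> {subset B n <= B m}.
  by move=> /subnK <-; elim: (m - n)%N => //= j IH x /IH /Bstep.
exists B => x.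
pose S : {pred A} := fun x => `[< exists n, spanmod (B n) x >].
have joint y z : y \in S -> z \in S ->
    exists n, spanmod (B n) y /\ spanmod (B n) z.
  move=> /asboolP[n yn] /asboolP[m zm]; exists (maxn n m); split.
    by apply: spanmod_sub yn; apply: Bmono; apply: leq_maxl.
  by apply: spanmod_sub zm; apply: Bmono; apply: leq_maxr.
suff /asboolP : x \in S by [].
apply: gen => [|a aS]; last first.
  by apply/asboolP; exists 0%N; apply: spanmod_mem; rewrite inE aS orbT.
split=> [|c y z /joint J /J[n [yn zn]]|y z /joint J /J[n [yn zn]]]; apply/asboolP.
- by exists 0%N; apply: spanmod_mem; apply: mem_head.
- by exists n; apply: spanmod_lin.
- exists n.+1; apply: (spanmod_sub _ (spanmod_mul yn zn)) => a ab.
  by rewrite mem_cat ab orbT.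
Qed.

Lemma spanmod_coord s x : spanmod s x ->
  exists c : nat -> k, x - \sum_(j < size s) c j *: s`_j \in P.
Proof.
elim: s x => [|a s IH] x /=; first by move=> xP; exists (fun=> 0); rewrite big_ord0 subr0.
case=> c /IH[d xd]; exists (fun j => if j is j'.+1 then d j' else c).
by rewrite big_ord_recl opprD addrA.
Qed.

(** The coordinate matrix has more rows than columns, so its left kernel is nonzero. *)
Lemma spanmod_dependent s m (v : 'I_m -> A) : (size s < m)%N ->
  (forall i, spanmod s (v i)) ->
  exists2 l : 'rV[k]_m, l != 0 & \sum_i l 0 i *: v i \in P.
Proof.
move=> sm vs.
have [c cP] := choice (fun i => spanmod_coord (vs i)).
pose M := \matrix_(i < m, j < size s) c i j.
have : kermx M != 0.
  by rewrite kermx_eq0 /row_free neq_ltn (leq_ltn_trans (rank_leq_col _) sm).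
move=> /rowV0Pn[l /sub_kermxP lM l0]; exists l => //.
have -> : \sum_i l 0 i *: v i =
    \sum_i l 0 i *: (v i - \sum_(j < size s) c i j *: s`_j).
  rewrite [RHS](eq_bigr (fun i => l 0 i *: v i - l 0 i *: \sum_(j < size s) c i j *: s`_j));
    last by move=> i _; rewrite scalerBr.
  rewrite sumrB -[LHS]subr0; congr (_ - _).
  under eq_bigr do rewrite scaler_sumr.
  rewrite exchange_big big1 //= => j _.
  have := congr1 (fun u : 'rV_(size s) => u 0 j) lM; rewrite !mxE => lMj.
  under eq_bigr do rewrite scalerA.
  rewrite -scaler_suml; apply: etrans (scale0r _); congr (_ *: _).
  by apply: etrans lMj; apply: eq_bigr => i _; rewrite mxE.
by apply: rpred_sum => i _; apply: idealZ.
Qed.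

End Span.

(** * A Nullstellensatz for ideals avoiding a countable family *)

Section Nullstellensatz.
Local Open Scope classical_set_scope.
Variables (k : closedFieldType) (A : comAlgType k) (P : prime_idealr A).
Local Notation spanmod := (spanmod P).
Variable h : nat -> A.

(** Properness is implied: an ideal containing [1] contains every [h n]. *)
Definition avoiding_ideal (I : set A) : Prop :=
  [/\ forall x, x \in P -> I x,
      forall a x y, I x -> I y -> I (a * x + y) &
      forall n, ~ I (h n)].

Hypothesis hP : forall n, h n \notin P.

Lemma maximal_avoiding_ideal : exists I : set A, avoiding_ideal I /\
  forall x, ~ I x -> exists n b, I (h n - b * x).
Proof.
have [F FQ Ftot|I [QI Imax]] :=
  (* The alternative [set0] covers the union of the empty chain; [P] itself shows that a maximal
     element is not empty. *)
  @Zorn_bigcup _ (fun I : set A => I = set0 \/ avoiding_ideal I).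
  have [[X [FX [x Xx]]]|none] := pselect (exists X, F X /\ X !=set0); last first.
    left; rewrite -subset0 => x [X FX Xx]; apply: none.
    by exists X; split=> //; exists x.
  have avoid Y y : F Y -> Y y -> avoiding_ideal Y.
    by move=> FY Yy; case: (FQ _ FY) => // Y0; rewrite Y0 in Yy.
  right; split=> [y yP|a y z [Y FY Yy] [Z FZ Zz]|n [Y FY Yh]].
  - by exists X => //; have [+ _ _] := avoid _ _ FX Xx; apply.
  - have [_ Ylin _] := avoid _ _ FY Yy; have [_ Zlin _] := avoid _ _ FZ Zz.
    have [YZ|ZY] := Ftot _ _ FY FZ.
      by exists Z => //; apply: Zlin => //; apply: YZ.
    by exists Y => //; apply: Ylin => //; apply: ZY.
  - by have [_ _ + ] := avoid _ _ FY Yh; apply; apply: Yh.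
have {QI}avI : avoiding_ideal I.
  case: QI => // I0; exfalso; apply: (Imax [set` P]).
    rewrite I0; split; first exact: sub0set.
    by move=> /(_ 0); apply; rewrite /= rpred0.
  right; split=> //= [a x y xP yP|n]; first by rewrite rpredD ?idealMr.
  by apply/negP.
exists I; split=> // x nIx; apply: contrapT => none.
have [PI Ilin Ih] := avI.
(* If adjoining [x] reached no [h n], then [I + A x] would be a strictly larger avoiding ideal. *)
apply: (Imax [set y | exists b, I (y - b * x)]).
  split=> [y Iy|]; first by exists 0; rewrite mul0r subr0.
  move=> /(_ x) sub; apply/nIx/sub; exists 1.
  by rewrite mul1r subrr; apply: PI; rewrite rpred0.
right; split=> [y yP|a y z [b yb] [c zc]|n [b hb]].
- by exists 0; rewrite mul0r subr0; apply: PI.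
- exists (a * b + c).
  have := Ilin a _ _ yb zc; congr (I _); ring.
- by apply: none; exists n, b.
Qed.

Variable I : set A.
Hypothesis avI : avoiding_ideal I.
Hypothesis maxI : forall x, ~ I x -> exists n b, I (h n - b * x).
Hypothesis h_mul : forall n m, exists l e, h l = e * (h n * h m).

Let idealP x : x \in P -> I x. Proof. by case: avI => + _ _; apply. Qed.

Let I0 : I 0. Proof. by apply: idealP; rewrite rpred0. Qed.

Let IM a x : I x -> I (a * x).
Proof. by move=> Ix; rewrite -[_ * _]addr0; case: avI => _ + _; apply. Qed.

Let ID x y : I x -> I y -> I (x + y).
Proof. by rewrite -{2}[x]mul1r; case: avI => _ + _; apply. Qed.

Let Ih n : ~ I (h n). Proof. by case: avI => _ _; apply. Qed.

(** This is the usual primality of an ideal maximal among those avoiding a multiplicative set; it is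
    enough that [h n * h m] divides some [h l]. *)
Lemma avoiding_prime x y : I (x * y) -> I x \/ I y.
Proof.
move=> Ixy; apply: contrapT => /not_orP[/maxI[n [b nb]] /maxI[m [c mc]]].
have [l [e hl]] := h_mul n m.
apply: (@Ih l); rewrite hl; apply: IM.
have -> : h n * h m = h m * (h n - b * x) + (b * x * (h m - c * y) + b * c * (x * y)).
  by ring.
by apply: ID; [exact: IM | apply: ID; apply: IM].
Qed.

Lemma avoiding_prod (T : Type) (r : seq T) (F : T -> A) :
  (forall i, ~ I (F i)) -> ~ I (\prod_(i <- r) F i).
Proof.
move=> nF; elim: r => [|i r IH]; rewrite ?big_nil ?big_cons.
  by move=> I1; apply: (@Ih 0%N); rewrite -[h _]mulr1; apply: IM.
by move=> /avoiding_prime[/nF|].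
Qed.

Lemma avoiding_horner (x : A) (q : {poly k}) : q != 0 ->
  I (horner_alg x q) -> exists c : k, I (x - c%:A).
Proof.
move=> q0; have [r ->] := closed_field_poly_normal q.
rewrite linearZ /= rmorph_prod => Iq; apply: contrapT => none.
apply: (@avoiding_prod _ r (fun c => x - c%:A)) => [c Ic|].
  by apply: none; exists c.
have := IM (lead_coef q)^-1%:A Iq.
rewrite !mulr_algl scalerA mulVf ?lead_coef_eq0 // scale1r.
congr (I _); apply: eq_bigr => c _.
by rewrite rmorphB /= horner_algX horner_algC.
Qed.

Variable B : nat -> seq A.
Hypothesis B_span : forall x, exists n, spanmod (B n) x.
Hypothesis uncountable : forall g : k -> nat, exists n, forall m,
  exists s : seq k, [/\ uniq s, size s = m & {in s, forall c, g c = n}].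

(** Otherwise every [x - c] divides some [h n] modulo [I], with a cofactor in the span of some
    [B m]. Infinitely many [c] share the same [n] and [m], so finitely many of their cofactors are
    dependent. Clearing denominators in this relation makes [x] algebraic modulo [I], hence a
    scalar. *)
Lemma avoiding_scalar x : exists c : k, I (x - c%:A).
Proof.
have [//|none] := pselect (exists c : k, I (x - c%:A)).
have inv c : exists nmb : nat * nat * A,
    I (h nmb.1.1 - nmb.2 * (x - c%:A)) /\ spanmod (B nmb.1.2) nmb.2.
  have [n [b nb]] : exists n b, I (h n - b * (x - c%:A)).
    by apply: maxI => Ic; apply: none; exists c.
  have [m mb] := B_span b.
  by exists (n, m, b).
have [g gP] := choice inv.
have [N /(_ _)NP] := uncountable (fun c => pickle (g c).1).
have [c0 gc0] : exists c0, pickle (g c0).1 = N.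
  have [s [_ s1 sN]] := NP 1%N; case: s s1 sN => // c0 s _ sN.
  by exists c0; apply: sN; apply: mem_head.
set n := (g c0).1.1; set m := (g c0).1.2.
have [s [us ss sN]] := NP (size (B m)).+1.
pose c (i : 'I_(size (B m)).+1) := s`_i.
have gc i : (g (c i)).1 = (g c0).1.
  apply: (pcan_inj pickleK); rewrite gc0 sN // mem_nth // ss; exact: ltn_ord.
have c_inj : injective c.
  move=> i j /eqP; rewrite /c nth_uniq ?ss ?ltn_ord // => /eqP; exact: val_inj.
pose b i := (g (c i)).2.
have bI i : I (h n - b i * (x - (c i)%:A)) by have [+ _] := gP (c i); rewrite gc.
have bB i : spanmod (B m) (b i) by have [_] := gP (c i); rewrite gc.
have [l l0 lb] := spanmod_dependent (ltnSn _) bB.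
(* This is the numerator of the sum of the [l 0 i / ('X - c i)]. At a [c i] with [l 0 i] nonzero
   only the term of index [i] survives, the [c j] being distinct. *)
pose q := \sum_i l 0 i *: \prod_(j | j != i) ('X - (c j)%:P).
have q0 : q != 0.
  have [i li] := rV0Pn _ l0.
  apply/eqP => /(congr1 (fun p => p.[c i])); rewrite horner0 horner_sum.
  rewrite (bigD1 i) //= [X in _ + X]big1 ?addr0 => [|j ji]; last first.
    apply/eqP; rewrite hornerZ horner_prod mulf_eq0; apply/orP; right.
    by apply/prodf_eq0; exists i; rewrite 1?eq_sym // hornerXsubC subrr.
  rewrite hornerZ horner_prod => /eqP; rewrite mulf_eq0 (negPf li) /=.
  rewrite prodf_seq_eq0 => /hasP[j _ /=]; rewrite hornerXsubC subr_eq0.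
  by case/andP=> /negPf ji /eqP/c_inj ij; rewrite ij eqxx in ji.
apply: (avoiding_horner q0).
have sub_prod i : \prod_j (x - (c j)%:A) =
    (x - (c i)%:A) * horner_alg x (\prod_(j | j != i) ('X - (c j)%:P)).
  rewrite (bigD1 i) //= rmorph_prod; congr (_ * _); apply: eq_bigr => j _.
  by rewrite rmorphB /= horner_algX horner_algC.
have Isum (F : 'I_(size (B m)).+1 -> A) : (forall i, I (F i)) -> I (\sum_i F i).
  by move=> IF; apply: (big_ind I).
suff /avoiding_prime[/Ih//|//] : I (h n * horner_alg x q).
(* Replacing [h n] by [b i * (x - c i)] in the term of index [i] completes its product to the full
   one, leaving the dependency relation as a factor. *)
have -> : h n * horner_alg x q =
    \sum_i horner_alg x (l 0 i *: \prod_(j | j != i) ('X - (c j)%:P)) *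
       (h n - b i * (x - (c i)%:A)) +
    \prod_j (x - (c j)%:A) * \sum_i l 0 i *: b i.
  rewrite linear_sum !mulr_sumr -big_split /=; apply: eq_bigr => i _.
  rewrite (sub_prod i) linearZ /= -[l 0 i *: b i]mulr_algl; ring.
by apply: ID; [apply: Isum => i; apply: IM | apply: IM; apply: idealP].
Qed.

End Nullstellensatz.

(* Imported only here: [measure] redefines the denominator notation [\d_ _]. *)
From mathcomp Require Import finmap functions cardinality ereal measure lebesgue_measure.

(** * Uncountability of the complex numbers *)

Local Open Scope classical_set_scope.

(** If [g] had only finite fibres on the real line, the reals would be countable and the interval
    from 0 to 1 would have Lebesgue measure zero. *)
Lemma complex_infinite_fibre (R : realType) (g : R[i] -> nat) :
  exists n, forall m,
  exists s : seq R[i], [/\ uniq s, size s = m & {in s, forall c, g c = n}].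
Proof.
suff [n fin] : exists n, ~ finite_set [set x : R | g (x%:C)%C = n].
  exists n => m; have [B Bg mB] := infinite_set_fset m fin.
  exists (take m [seq (x%:C)%C | x <- B]); split.
  - by rewrite take_uniq // map_inj_uniq ?fset_uniq // => x y [].
  - by rewrite size_takel // size_map.
  - by move=> c /mem_take/mapP[x xB ->]; apply: Bg.
apply: contrapT => fin.
have : countable [set: R].
  rewrite (_ : [set: R] = \bigcup_n [set x : R | g (x%:C)%C = n]).
    apply: bigcup_countable => // n _; apply: finite_set_countable.
    by apply: contrapT => nf; apply: fin; exists n.
  by apply/seteqP; split=> x // _; exists (g (x%:C)%C).
move=> /(@sub_countable _ _ `[0, 1] _ (subset_card_le (@subsetT _ _))).
move=> /countable_lebesgue_measure0.
rewrite lebesgue_measure_itv /= lte_fin ltr01 oppr0 adde0 => /eqP.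
by rewrite eqe oner_eq0.
Qed.

Local Close Scope classical_set_scope.

(* Theorem 3.2: for a complex affine Poisson algebra A and a Poisson prime
   ideal P of A, if P is Poisson rational then P is Poisson primitive.
   C is modelled as R[i] for R : realType. *)
Theorem theorem3p2 (R : realType) (A : comAlgType R[i]) (br : A -> A -> A)
    (P : prime_idealr A) :
  is_poisson_bracket br ->
  affine A ->
  poisson_ideal br P ->
  poisson_rational br P ->
  poisson_primitive br P.
Proof.
move=> brP [fg _] PP rat.
have [B Bspan] := finitely_generated_filtration P fg.
have ratP := rational_centre brP PP rat.
have [f fP] := choice (fun n => (exists2P _ _).1 (poisson_witness brP PP ratP (B n))).
(* The square makes [h n * h m] divide a later term; the factor [f m] keeps every [f m] out of an
   ideal avoiding [h]. *)
pose h := fix h n := if n is m.+1 then f m * (h m * h m) else 1.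
have hP n : h n \notin P.
  elim: n => [|n IH] /=; first by rewrite idealr1.
  by rewrite !prime_idealrM !negb_or IH (fP n).1.
have h_dvd n m : (n <= m)%N -> exists e, h m = e * h n.
  move=> /subnK <-; elim: (m - n)%N => [|j [e he]]; first by exists 1; rewrite mul1r.
  by exists (f (j + n)%N * h (j + n)%N * e); rewrite /= {2}he !mulrA.
have h_mul n m : exists l e, h l = e * (h n * h m).
  have [e1 h1] := h_dvd _ _ (leq_maxl n m).
  have [e2 h2] := h_dvd _ _ (leq_maxr n m).
  exists (maxn n m).+1, (f (maxn n m) * (e1 * e2)).
  by rewrite /= {1}h1 h2; ring.
have [I [avI maxI]] := maximal_avoiding_ideal hP.
have scalar := avoiding_scalar avI maxI h_mul Bspan (@complex_infinite_fibre R).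
have [PI Ilin Ih] := avI.
exists (fun x => `[< I x >]); split; last split=> //.
- split; first split=> [||a x y /asboolP Ix /asboolP Iy].
  + by apply/asboolP/PI; rewrite rpred0.
  + by apply/asboolP; apply: (Ih 0%N).
  + by apply/asboolP/Ilin.
  (* An [x] in [J] is a scalar [c] modulo [I]; a nonzero [c] would lie in [J] and put [1] there. *)
  move=> J [J0 J1 Jlin] MJ x; apply/idP/idP => [xJ|/MJ//].
  have [c Ixc] := scalar x.
  have [c0|c0] := eqVneq c 0.
    by apply/asboolP; rewrite c0 scale0r subr0 in Ixc.
  have xcJ : x - c%:A \in J by apply/MJ/asboolP.
  case/negP: J1; have := Jlin (c^-1)%:A _ _ (Jlin (-1) _ _ xcJ xJ) J0.
  by rewrite mulN1r opprB subrK addr0 mulr_algl scalerA mulVf // scale1r.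
- by move=> x xP; apply/asboolP/PI.
- move=> J [[J0 _ Jlin] Jbr] JM x xJ; apply: contrapT => /negP xP.
  have [n xn] := Bspan x.
  have JMr a y : y \in J -> a * y \in J.
    by move=> yJ; rewrite -[_ * _]addr0; apply: Jlin.
  (* The witness property needs a stable set containing [P], so [J] is enlarged to [J + P], which
     still lies in [I]. *)
  pose N y := exists2 j, j \in J & y - j \in P.
  have sN : poisson_stable br N.
    split=> [a b y z [j jJ yj] [l lJ zl]|y z [j jJ yj]].
      exists (a * j - b * l).
        by rewrite -mulNr; apply: Jlin => //; apply: JMr.
      have := rpredB (idealMr a yj) (idealMr b zl); congr (_ \in P); ring.
    by exists (br j z); [exact: Jbr | rewrite -(brBl brP); exact: br_inl].
  have PN y : y \in P -> N y by move=> yP; exists 0; rewrite ?subr0.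
  have Nx : N x by exists x; rewrite // subrr rpred0.
  (* An element of [J] outside [P] forces [f n] into [J + P], hence its multiple [h n.+1] into [I],
     a contradiction. *)
  have [j /JM/asboolP Ij /PI Ifj] := (fP n).2 N sN PN x Nx xn xP.
  have Ifn : I (f n) by rewrite -(subrK j (f n)) -[_ - j]mul1r; apply: (Ilin 1).
  apply: (Ih n.+1); rewrite /= mulrC -[_ * f n]addr0.
  by apply: Ilin => //; apply: PI; rewrite rpred0.
Qed.
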